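(* Let $\gamma_X=(X,d_X(\cdot))$ be a tame dynamic metric space over $X$ and let $\delta\ge0$. Then, defining $\mathcal{R}^1_\delta(\gamma_X)(t):=\mathcal{R}^1_\delta(\gamma_X(t))$ for $t\in\mathbb{R}$, the map $\mathcal{R}^1_\delta(\gamma_X):\mathbb{R}\to\mathrm{Graph}(X)$ is a saturated dynamic graph over $X$.
   Context: A dynamic metric space (DMS) is a pair $\gamma_X=(X,d_X(\cdot))$ where $X$ is a nonempty finite set and $d_X:\mathbb{R}\times X\times X\to\mathbb{R}_+$ satisfies: (i) for each $t\in\mathbb{R}$, $\gamma_X(t)=(X,d_X(t))$ is a pseudo-metric space; (ii) for $x\ne x'$ in $X$ the function $t\mapsto d_X(t)(x,x')$ is not identically zero; (iii) for all $x,x'\in X$ the function $t\mapsto d_X(t)(x,x')$ is continuous. A continuous function $f:\mathbb{R}\to\mathbb{R}$ is tame if for every $c\in\mathbb{R}$ and every finite (bounded) interval $I\subset\mathbb{R}$ the set $f^{-1}(c)\cap I$ has only finitely many connected components (possibly none). A DMS is tame if all functions $t\mapsto d_X(t)(x,x')$ are tame. For $\delta\ge0$ and a finite (pseudo-)metric space $(X,d_X)$, $\mathcal{R}^1_\delta(X,d_X)$ is the simple graph with vertex set $X$ and edge set $\{\{x,x'\}:x\ne x',\ d_X(x,x')\le\delta\}$. $\mathrm{Graph}(X)$ is the lattice of subgraphs of the complete graph on $X$ ordered by inclusion. A dynamic graph over $X$ is a map $\mathcal{G}_X:\mathbb{R}\to\mathrm{Graph}(X)$ such that: there is a locally finite set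 $C\subset\mathbb{R}$ with $\mathcal{G}_X$ constant on each connected component of $\mathbb{R}\setminus C$ and, for every $c\in C$, there is $r_c>0$ with $\mathcal{G}_X(c-\varepsilon)\le\mathcal{G}_X(c)\ge\mathcal{G}_X(c+\varepsilon)$ for all $\varepsilon\in[0,r_c)$; and every $x\in X$ has a closed interval $I_x\subset\mathbb{R}$ (lifespan, possibly unbounded) such that $x$ is a vertex of $\mathcal{G}_X(t)$ iff $t\in I_x$. It is saturated if all $x\in X$ have the same lifespan. *)

(* Defs.v *)
From HB Require Import structures.
From mathcomp Require Import all_boot all_order all_algebra.
From mathcomp Require Import all_classical all_reals all_analysis.
Set Implicit Arguments.
Unset Strict Implicit.
Unset Printing Implicit Defensive.
Import Order.TTheory GRing.Theory Num.Theory.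
Import numFieldNormedType.Exports.
Local Open Scope classical_set_scope.
Local Open Scope ring_scope.

Section Graph.
Variable X : finType.

(* A graph is a pair (V, E) of a vertex set V, which may be a proper subset
   of X, and a set E of two-element subsets of V. *)
Definition is_graph (G : {set X} * {set {set X}}) : bool :=
  [forall e : {set X}, (e \in G.2) ==> (#|e| == 2)%N && (e \subset G.1)].

Record Graph := MkGraph {
  graph_val : {set X} * {set {set X}};
  graph_valP : is_graph graph_val }.

HB.instance Definition _ := [isSub for graph_val].
HB.instance Definition _ := [Equality of Graph by <:].

Definition vertices (G : Graph) : {set X} := (graph_val G).1.
Definition edges (G : Graph) : {set {set X}} := (graph_val G).2.

Definition subgraph (G H : Graph) : bool :=
  (vertices G \subset vertices H) && (edges G \subset edges H).

End Graph.

Section DynamicMetricSpace.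
Variables (R : realType) (X : finType).

Record is_pseudometric (dX : X -> X -> R) : Prop := {
  pseudometric_ge0 : forall x y, 0 <= dX x y;
  pseudometric_xx : forall x, dX x x = 0;
  pseudometric_sym : forall x y, dX x y = dX y x;
  pseudometric_triangle : forall x y z, dX x z <= dX x y + dX y z }.

Record is_dms (d : R -> X -> X -> R) : Prop := {
  dms_nonempty : (0 < #|X|)%N;
  dms_pseudometric : forall t, is_pseudometric (d t);
  dms_neq0 : forall x y, x != y -> exists t, d t x y != 0;
  dms_continuous : forall x y, continuous (fun t => d t x y) }.

Definition connected_components (A : set R) : set (set R) :=
  [set connected_component A t | t in A].

(* Tameness is only meant for continuous f; continuity is not repeated here
   since it is part of [is_dms]. *)
Definition tame (f : R -> R) : Prop :=
  forall (c : R) (I : set R), is_interval I -> bounded_set I ->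
    finite_set (connected_components (f @^-1` [set c] `&` I)).

Definition tame_dms (d : R -> X -> X -> R) : Prop :=
  forall x y, tame (fun t => d t x y).

End DynamicMetricSpace.

Section DynamicGraph.
Variables (R : realType) (X : finType).

Definition locally_finite_set (C : set R) : Prop :=
  forall I : set R, is_interval I -> bounded_set I -> finite_set (C `&` I).

Definition tame_graph_map (G : R -> Graph X) : Prop :=
  exists C : set R,
    [/\ locally_finite_set C,
        forall K, connected_components (~` C) K ->
          forall s t, K s -> K t -> G s = G t &
        forall c, C c -> exists r : R, 0 < r /\
          forall e : R, 0 <= e < r ->
            subgraph (G (c - e)) (G c) /\ subgraph (G (c + e)) (G c)].

Definition lifespan (G : R -> Graph X) (x : X) : set R :=
  [set t | x \in vertices (G t)].

Record is_dynamic_graph (G : R -> Graph X) : Prop := {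
  dynamic_graph_tame : tame_graph_map G;
  dynamic_graph_lifespan : forall x,
    [/\ lifespan G x !=set0, is_interval (lifespan G x) &
        closed (lifespan G x)] }.

Definition saturated (G : R -> Graph X) : Prop :=
  forall x y, lifespan G x = lifespan G y.

End DynamicGraph.

Section RipsGraph.
Variables (R : realType) (X : finType).

Definition rips_edges (delta : R) (dX : X -> X -> R) : {set {set X}} :=
  [set [set p.1; p.2]%SET | p : X * X & (p.1 != p.2) && (dX p.1 p.2 <= delta)]%SET.

Lemma rips_is_graph (delta : R) (dX : X -> X -> R) :
  is_graph ([set: X]%SET, rips_edges delta dX).
Proof.
apply/forallP => e; apply/implyP => /imsetP[p]; rewrite inE => /andP[pq _] ->.
by rewrite cards2 pq finset.subsetT.
Qed.

Definition rips_graph (delta : R) (dX : X -> X -> R) : Graph X :=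
  MkGraph (rips_is_graph delta dX).

Definition dynamic_rips_graph (delta : R) (d : R -> X -> X -> R) :
    R -> Graph X :=
  fun t => rips_graph delta (d t).

End RipsGraph.

(* Main.v *)
(* The edge {x, y} is present exactly on the closed set {t | d t x y <= delta},
   so the graph can only change at a frontier point of one of these sets, and
   absent edges stay absent nearby, which gives the inclusions at such points.
   At a frontier point d t x y = delta, and a component of the level set
   (within a bounded interval) is an interval whose interior points are not
   frontier points: it contributes at most its two endpoints, and tameness
   bounds the number of components. *)
Require Import Defs.
From mathcomp Require Import all_boot all_order all_algebra.
From mathcomp Require Import all_classical all_reals all_analysis.
Import Order.TTheory GRing.Theory Num.Theory.
Import numFieldNormedType.Exports.
Local Open Scope ring_scope.
Local Open Scope classical_set_scope.

Definition sublevel {R : realType} (f : R -> R) (c : R) : set R :=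
  [set t | f t <= c].

(* Sublevel sets of a continuous function are closed, so this is the
   topological frontier. *)
Definition sublevel_frontier {R : realType} (f : R -> R) (c : R) : set R :=
  sublevel f c `\` (sublevel f c)°.

Lemma closed_sublevel {R : realType} (f : R -> R) (c : R) :
  continuous f -> closed (sublevel f c).
Proof. by move=> fc; apply: (preimage_closed _ (@closed_le R c)) => t _. Qed.

(** If [f t < c], continuity keeps [f] below [c] around [t], which makes [t] interior to the
    sublevel set. *)
Lemma sublevel_frontier_level {R : realType} (f : R -> R) (c : R) :
  continuous f -> sublevel_frontier f c `<=` f @^-1` [set c].
Proof.
move=> fc t [/= ftc tNint]; apply/eqP; rewrite eq_le ftc leNgt.
apply/negP => ft_lt; apply: tNint.
have : \forall s \near t, f s < c by exact: (fc t _ (lt_nbhsl ft_lt)).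
by apply: filterS => s /ltW.
Qed.

Lemma sublevel_frontier_locally_finite {R : realType} (f : R -> R) (c : R) :
  continuous f -> tame f -> locally_finite_set (sublevel_frontier f c).
Proof.
move=> fc ft I itvI bndI.
pose Z := f @^-1` [set c] `&` I.
have finZ : finite_set (connected_components Z) by exact: ft.
apply: (@sub_finite_set _ _ (\bigcup_(K in connected_components Z)
  [set inf K; sup K])); last by apply: bigcup_finite => // K _; exact: finite_set2.
move=> t [Bt It].
have Zt : Z t by split=> //; exact: sublevel_frontier_level Bt.
exists (connected_component Z t); first by exists t.
set K := connected_component Z t.
have Kt : K t by exact: connected_component_refl.
have KZ : K `<=` Z by exact: connected_component_sub.
have itvK : is_interval K.
  by apply/connected_intervalP; exact: component_connected.
(* Boundedness makes [inf K] and [sup K] genuine bounds of [K] rather than default values. *)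
have [lbK ubK] : has_lbound K /\ has_ubound K.
  have [M [_ MI]] := bndI.
  (* [bounded_set] gives a bound by every real strictly above [M], hence [M + 1]. *)
  have KM s : K s -> `|s| <= M + 1.
    by move=> /KZ[_ Is]; apply: MI Is; rewrite ltrDl.
  by split; [exists (- (M + 1))|exists (M + 1)] => s /KM; rewrite ler_norml => /andP[].
have infKt : inf K <= t by exact: ge_inf.
have tsupK : t <= sup K by exact: ub_le_sup.
have [->|tNinf] := eqVneq t (inf K); first by left.
have [->|tNsup] := eqVneq t (sup K); first by right.
(* Now [t] lies strictly between the endpoints of [K], hence in its interior, and [K] is contained
   in the sublevel set. *)
case: Bt => _ []; apply: (@interiorS _ K).
  by move=> s /KZ[/= fsc _]; rewrite /sublevel /= fsc.
rewrite interval_bounded_interior //= !lt_neqAle infKt tsupK tNsup eq_sym.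
by rewrite tNinf.
Qed.

(** Within [K] the sublevel set coincides with its interior, so its trace on [K] is relatively
    clopen; as it contains [s], it is all of [K]. *)
Lemma le_on_connected {R : realType} (f : R -> R) (c : R) (K : set R) :
  continuous f -> connected K -> K `<=` ~` sublevel_frontier f c ->
  forall s t, K s -> K t -> f s <= c -> f t <= c.
Proof.
move=> fc connK KN s t Ks Kt fs.
suff : K `&` sublevel f c = K by move=> /seteqP[_ /(_ t Kt)[]].
apply: connK; first by exists s.
- exists (sublevel f c)°; first exact: open_interior.
  apply/seteqP; split=> u [Ku Au]; split=> //; last exact: interior_subset Au.
  by apply: contrapT => uNint; apply: (KN u Ku).
- by exists (sublevel f c) => //; exact: closed_sublevel.
Qed.

Lemma rips_graph_subgraph {R : realType} {X : finType} (delta : R)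
    (dX dY : X -> X -> R) :
  (forall x y, dX x y <= delta -> dY x y <= delta) ->
  subgraph (rips_graph delta dX) (rips_graph delta dY).
Proof.
move=> dXY; rewrite /subgraph subxx /=; apply/fintype.subsetP => e /imsetP[p].
rewrite inE => /andP[pq dp] ->; apply/imsetP; exists p => //.
by rewrite inE pq /= dXY.
Qed.

Lemma subgraph_anti {X : finType} (G H : Graph X) :
  subgraph G H -> subgraph H G -> G = H.
Proof.
case: G H => [[V E] GP] [[W F] HP] /andP[/= VW EF] /andP[/= WV FE].
by apply: val_inj; congr (_, _); apply/eqP; rewrite finset.eqEsubset; apply/andP.
Qed.

(** The condition [delta < d s x y] is open in [s], and as there are finitely many pairs, one
    neighbourhood of [t] serves them all. *)
Lemma dynamic_rips_graph_near {R : realType} {X : finType}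
    {d : R -> X -> X -> R} (delta : R) (t : R) :
  (forall x y, continuous (fun t => d t x y)) ->
  \forall s \near t, subgraph (dynamic_rips_graph delta d s)
                              (dynamic_rips_graph delta d t).
Proof.
move=> dc.
pose P (p : X * X) s := d s p.1 p.2 <= delta -> d t p.1 p.2 <= delta.
have : \forall s \near t, forall p, P p s.
  apply: (@filter_forall _ _ P (nbhs t)) => -[x y]; rewrite /P /=.
  have [dt|dt] := leP (d t x y) delta; first exact: nearW.
  have : \forall s \near t, delta < d s x y by exact: (dc x y t _ (lt_nbhsr dt)).
  by apply: filterS => s; rewrite ltNge => /negP.
by apply: filterS => s st; apply: rips_graph_subgraph => x y; exact: (st (x, y)).
Qed.

Lemma dynamic_rips_graph_lifespan {R : realType} {X : finType}
    {d : R -> X -> X -> R} (delta : R) (x : X) :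
  lifespan (dynamic_rips_graph delta d) x = setT.
Proof. by apply/seteqP; split=> t // _; rewrite /lifespan /= finset.in_setT. Qed.

Lemma dynamic_rips_graph_tame {R : realType} {X : finType}
    {d : R -> X -> X -> R} (delta : R) :
  (forall x y, continuous (fun t => d t x y)) -> tame_dms d ->
  tame_graph_map (dynamic_rips_graph delta d).
Proof.
move=> dc dt.
pose B (p : X * X) := sublevel_frontier (fun t => d t p.1 p.2) delta.
exists (\bigcup_p B p); split.
- move=> I itvI bndI; rewrite setI_bigcupl; apply: bigcup_finite => // p _.
  exact: sublevel_frontier_locally_finite.
- move=> K [u _ <-{K}]; set K := connected_component _ _.
  (* Since [s] and [t] can be exchanged, this inclusion gives equality by antisymmetry. *)
  have mono s t : K s -> K t ->
      subgraph (dynamic_rips_graph delta d s) (dynamic_rips_graph delta d t).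
    move=> Ks Kt; apply: rips_graph_subgraph => x y.
    apply: (le_on_connected (fun t => d t x y) delta K) => //.
      exact: component_connected.
    by move=> v /connected_component_sub; apply: contra_not => Bv; exists (x, y).
  by move=> s t Ks Kt; apply: subgraph_anti; apply: mono.
- move=> c _.
  (* [r] is the radius of a ball around [c] on which the inclusion holds; [c - e] and [c + e] are
     both at distance [e] from [c]. *)
  have [r /= r0 rc] := dynamic_rips_graph_near delta c dc.
  exists r; split=> // e /andP[e0 er]; split; apply: rc => /=.
    by rewrite opprB addrCA subrr addr0 ger0_norm.
  by rewrite opprD addNKr normrN ger0_norm.
Qed.

Theorem proposition7p5 (R : realType) (X : finType) (d : R -> X -> X -> R)
    (d_dms : is_dms d) (d_tame : tame_dms d) (delta : R) (delta_ge0 : 0 <= delta) :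
  is_dynamic_graph (dynamic_rips_graph delta d) /\
  saturated (dynamic_rips_graph delta d).
Proof.
split; last by move=> x y; rewrite !dynamic_rips_graph_lifespan.
split; first by apply: dynamic_rips_graph_tame => //; exact: dms_continuous.
move=> x; rewrite dynamic_rips_graph_lifespan; split=> //.
by exists 0.
Qed.
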